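(* Let $\alpha \in (0,1]$ and $\lambda \in \mathbb{R}$. Then the functional equation $$E_{\alpha}(\lambda (t+s)^{\alpha}) = E_{\alpha}(\lambda t^{\alpha})\,E_{\alpha}(\lambda s^{\alpha}), \quad \text{for all } t, s \in [0,\infty),$$ holds if and only if either $\alpha = 1$ or $\lambda = 0$.
   Context: For $\alpha > 0$, the Mittag-Leffler function $E_\alpha$ is the entire function defined by $E_{\alpha}(z) = \sum_{n=0}^\infty \frac{z^n}{\Gamma(\alpha n + 1)}$ for $z \in \mathbb{C}$, where $\Gamma$ is the Gamma function; it takes real values at real arguments. *)

(* Defs.v *)
From mathcomp Require Import all_boot all_order all_algebra.
From mathcomp Require Import all_classical all_reals all_analysis.
From mathcomp Require Export complex.

Set Implicit Arguments.
Unset Strict Implicit.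
Unset Printing Implicit Defensive.

Import Order.TTheory GRing.Theory Num.Theory.
Import numFieldNormedType.Exports.

Local Open Scope classical_set_scope.
Local Open Scope ring_scope.
Local Open Scope complex_scope.

(* Euler's integral of the second kind; meaningful for 0 < x only.  Since
   Rintegral is total, the value for x <= 0 is junk (the integral is infinite). *)
Definition Gamma (R : realType) (x : R) : R :=
  \int[@lebesgue_measure R]_(u in `]0, +oo[) (u `^ (x - 1) * expR (- u)).

(* The regular module R[i]^o carries the topology of the complex modulus; the
   series converges for every z when 0 < alpha, so that limn is its sum. *)
Definition mittag_leffler (R : realType) (alpha : R) (z : R[i]) : R[i] :=
  limn (series (fun n => z ^+ n / (Gamma (alpha * n%:R + 1))%:C) : R[i]^o ^nat).

(* Main.v *)
Require Import Defs.
From mathcomp Require Import all_boot all_order all_algebra.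
From mathcomp Require Import all_classical all_reals all_analysis.
From mathcomp Require Import complex measurable_realfun.
From mathcomp Require Import ring lra.
Import Order.TTheory GRing.Theory Num.Theory.
Import numFieldNormedType.Exports.
Local Open Scope classical_set_scope.
Local Open Scope ring_scope.
Local Open Scope complex_scope.

(** For alpha = 1 the Mittag-Leffler function is the exponential, because
    Gamma (n + 1) = n! ([mittag_leffler1]), and for lambda = 0 every value in
    the equation is E_alpha(0) = 1.

    Conversely, the diagonal t = s alone forces alpha = 1 or lambda = 0.  With
    tau = t ^ alpha it reads E(2 ^ alpha * lambda * tau) = E(lambda * tau) ^ 2
    for all tau >= 0.  Near 0 we have E(x) = 1 + c x + O(x ^ 2) with
    c = 1 / Gamma (alpha + 1) nonzero ([real_mittag_leffler_first_order]), so
    subtracting 1, dividing by tau and letting tau tend to 0 from the right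
    gives 2 ^ alpha * lambda * c = 2 * lambda * c.  If lambda is nonzero then
    2 ^ alpha = 2, and alpha = 1 ([eq1_of_mittag_leffler_doubling]).

    The expansion of E near 0 only needs the coefficients
    1 / Gamma (alpha n + 1) to be bounded: for x >= 0, Gamma (x + 1) is at least the integral of
    exp (- u) over [1, +oo[, which is exp (- 1) ([expRN1_le_Gamma]).  All the
    values involved are real, hence can be computed with real series
    ([mittag_leffler_real]). *)

(** * The Gamma integral *)

Lemma is_derive_series_exp_coeff {R : realType} (n : nat) (x : R) :
  is_derive x 1 (fun u : R => series (exp_coeff u) n.+1)
    (series (exp_coeff x) n).
Proof.
elim: n => [|n IHn].
  rewrite (_ : (fun u => _) = cst 1); last first.
    by apply/funext => u; rewrite /series/= big_nat1 /exp_coeff/= expr0 divr1.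
  by rewrite /series/= big_geq//; exact: is_derive_cst.
rewrite (_ : (fun u => _) = (fun u : R => series (exp_coeff u) n.+1)
   + (n.+1`!%:R^-1 \*: (id ^+ n.+1 : R -> R))); last first.
  apply/funext => u; rewrite [LHS]seriesSr/=.
  by rewrite /GRing.add/=/exp_coeff/= mulrC; congr (_ + _ * _); rewrite fctE.
apply: is_derive_eq.
rewrite [RHS]seriesSr; congr (_ + _).
rewrite /exp_coeff/= /GRing.scale/= mulr1 factS natrM invfM.
by rewrite mulrACA mulVf ?pnatr_eq0// mul1r mulrC.
Qed.

(** Already the term of degree n + 1 of the exponential series outgrows
    u ^ n, by a factor proportional to u. *)
Lemma cvgr_exprn_expRN {R : realType} (n : nat) :
  (u ^+ n * expR (- u) : R) @[u --> +oo%R] --> 0.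
Proof.
apply: (@squeeze_cvgr _ _ _ _ (cst 0) (fun u : R => n.+1`!%:R * u^-1)).
- near=> u.
  have u0 : 0 < u by near: u; exact: nbhs_pinfty_gt.
  rewrite /cst mulr_ge0 ?exprn_ge0 ?expR_ge0 ?(ltW u0)//=.
  rewrite expRN ler_pdivrMr ?expR_gt0// mulrAC ler_pdivlMr// -exprSr.
  rewrite mulrC -ler_pdivrMr ?ltr0n ?fact_gt0//.
  by apply: le_trans (expR_ge1Dxn n (ltW u0)); rewrite lerDr.
- exact: cvg_cst.
- rewrite -[X in _ --> X](mulr0 (n.+1`!%:R : R)).
  apply: cvgMl_tmp; apply/gtr0_cvgV0; last exact: cvg_id.
  by near=> u; near: u; exact: nbhs_pinfty_gt.
Unshelve. all: end_near. Qed.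

(** An explicit antiderivative is - n! exp (- u) p(u), where p is the degree-n
    Taylor polynomial of the exponential: since p' = p - u ^ n / n!, the
    derivative of exp (- u) p(u) collapses to - exp (- u) u ^ n / n!. *)
Lemma integral_exprn_expRN {R : realType} (n : nat) :
  (\int[@lebesgue_measure R]_(u in `[0%R, +oo[) (u ^+ n * expR (- u))%:E
   = (n`!%:R)%:E)%E.
Proof.
pose F (u : R) := - n`!%:R * (expR (- u) * series (exp_coeff u) n.+1).
have dexpN (u : R) : is_derive u 1 (fun u : R => expR (- u)) (- expR (- u)).
  by apply: is_derive_eq; rewrite mulrN1.
have dF (u : R) : is_derive u 1 F (u ^+ n * expR (- u)).
  have ? := is_derive_series_exp_coeff n u.
  rewrite (_ : F = (- n`!%:R) \*: ((fun u : R => expR (- u))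
                                * (fun u : R => series (exp_coeff u) n.+1)))//.
  apply: is_derive_eq.
  rewrite [series _ n.+1]seriesSr /GRing.scale/= /exp_coeff/=.
  by field; rewrite pnatr_eq0 -lt0n fact_gt0.
have cF (u : R) : {for u, continuous F}.
  by apply: differentiable_continuous; apply/derivable1_diffP; case: (dF u).
have F_y : F u @[u --> +oo%R] --> 0.
  rewrite -[X in _ --> X](mulr0 (- n`!%:R : R)).
  apply: cvgMl_tmp; elim: {F dF cF} n.+1 => [|m IHm].
    rewrite (_ : (fun u => _) = cst 0); first exact: cvg_cst.
    by apply/funext => u; rewrite /series/= big_geq// mulr0.
  rewrite (_ : (fun u => _) = fun u : R => expR (- u) * series (exp_coeff u) m
      + u ^+ m * expR (- u) * m`!%:R^-1); last first.
    apply/funext => u.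
    by rewrite seriesSr mulrDr /exp_coeff/= mulrA [expR _ * u ^+ m]mulrC.
  rewrite -[X in _ --> X]addr0; apply: cvgD => //.
  rewrite -[X in _ --> X](mul0r (m`!%:R^-1 : R)).
  by apply: cvgMr_tmp; exact: cvgr_exprn_expRN.
rewrite (@ge0_continuous_FTC2y _ _ F _ 0)//.
- rewrite /F oppr0 expR0 mul1r series_exp_coeff0 mulr1.
  by rewrite -EFinB opprK add0r.
- by move=> u u0; rewrite mulr_ge0 ?exprn_ge0 ?expR_ge0.
- apply: derivable_within_continuous => u _.
  by apply: derivableM; [exact: exprn_derivable|case: (dexpN u)].
- by apply: cvg_at_right_filter; exact: cF.
- by move=> u _; rewrite derive1E; exact: derive_val.
Qed.

Lemma integral_expRN_itv1y {R : realType} :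
  (\int[@lebesgue_measure R]_(u in `[1%R, +oo[) (expR (- u))%:E
   = (expR (- 1))%:E)%E.
Proof.
have dF (u : R) : is_derive u 1 (fun u : R => - expR (- u)) (expR (- u)).
  by apply: is_derive_eq; rewrite mulrN1 opprK.
have cF (u : R) : {for u, continuous (fun u : R => - expR (- u))}.
  by apply: differentiable_continuous; apply/derivable1_diffP; case: (dF u).
rewrite (@ge0_continuous_FTC2y _ _ (fun u : R => - expR (- u)) _ 0).
- by rewrite -EFinB opprK add0r.
- by move=> u _; exact: expR_ge0.
- by apply: derivable_within_continuous => u _.
- by rewrite -oppr0; apply: cvgN; exact: cvgr_expR.
- by move=> u _; case: (dF u).
- by apply: cvg_at_right_filter; exact: cF.
- by move=> u _; rewrite derive1E; exact: derive_val.
Qed.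

Section Gamma_facts.
Context {R : realType}.
Local Notation mu := (@lebesgue_measure R).

Lemma measurable_Gamma_integrand (D : set R) (x : R) :
  measurable_fun D (fun u : R => (u `^ x * expR (- u))%:E).
Proof.
apply/measurable_EFinP; apply: measurable_funTS; apply: measurable_funM => //.
exact: measurableT_comp.
Qed.

Lemma integral_powR_natr_expRN (n : nat) :
  (\int[mu]_(u in `]0%R, +oo[) (u `^ n%:R * expR (- u))%:E = (n`!%:R)%:E)%E.
Proof.
rewrite integral_itv_obnd_cbnd; last exact: measurable_Gamma_integrand.
rewrite (eq_integral (mu := mu) (fun u : R => (u ^+ n * expR (- u))%:E)).
  exact: integral_exprn_expRN.
by move=> u; rewrite inE/= in_itv/= andbT => u0; rewrite powR_mulrn.
Qed.

Lemma Gamma_natrS (n : nat) : Gamma (n%:R + 1 : R) = n`!%:R.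
Proof. by rewrite /Gamma addrK /Rintegral integral_powR_natr_expRN. Qed.

(** The bound comes from the part u >= 1 of the integral, where u ^ x >= 1.
    Since [Gamma] is the finite part of the integral, the integral must also be
    shown finite: u ^ x <= 1 + u ^ n for any natural number n >= x. *)
Lemma expRN1_le_Gamma (x : R) : 0 <= x -> expR (- 1) <= Gamma (x + 1).
Proof.
move=> x0; rewrite /Gamma addrK /Rintegral -lee_fin.
have mf (y : R) := measurable_Gamma_integrand `]0%R, +oo[%classic y.
have f0 (y u : R) : (0 <= (u `^ y * expR (- u))%:E)%E.
  by rewrite lee_fin mulr_ge0 ?powR_ge0 ?expR_ge0.
rewrite fineK.
- rewrite -integral_expRN_itv1y.
  apply: (@le_trans _ _
    (\int[mu]_(u in `[1%R, +oo[) (u `^ x * expR (- u))%:E)%E).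
    apply: ge0_le_integral => //.
    + apply/measurable_EFinP; apply: measurable_funTS.
      exact: measurableT_comp.
    + exact: measurable_Gamma_integrand.
    + move=> u; rewrite /= in_itv/= andbT => u1.
      rewrite lee_fin ler_peMl ?expR_ge0//.
      by rewrite -(powRr0 u) ler_powR.
  apply: ge0_subset_integral => //; first exact: mf.
  by move=> u /=; rewrite !in_itv/= !andbT; exact: lt_le_trans.
- rewrite ge0_fin_numE; last exact: integral_ge0.
  have [n xn] : exists n : nat, x <= n%:R.
    by exists (Num.truncn x).+1; apply: ltW; exact: truncnS_gt.
  have fin (m : nat) :
      (\int[mu]_(u in `]0%R, +oo[) (u `^ m%:R * expR (- u))%:E < +oo)%E.
    by rewrite integral_powR_natr_expRN ltry.
  apply: (@le_lt_trans _ _ (\int[mu]_(u in `]0%R, +oo[)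
    ((u `^ 0%:R * expR (- u))%:E + (u `^ n%:R * expR (- u))%:E))%E).
    apply: ge0_le_integral => //.
    + exact: mf.
    + exact: (emeasurable_funD (mf _) (mf _)).
    + move=> u; rewrite /= in_itv/= andbT => u0.
      rewrite -EFinD lee_fin -mulrDl ler_wpM2r ?expR_ge0// powRr0.
      have [u1|/ltW u1] := leP u 1.
        by rewrite -[leLHS]addr0 lerD ?powR_ge0// -(powRr0 u) ger_powR ?u0.
      by rewrite -[leLHS]add0r lerD// ler_powR.
  rewrite ge0_integralD//; [|exact: mf|exact: mf].
  exact: (lte_add_pinfty (fin 0%N) (fin n)).
Qed.

End Gamma_facts.

(** * Reduction to real power series *)

Lemma cvg_real_complex {R : realType} (f : R^nat) (l : R) :
  f @ \oo --> l -> (fun n => (f n)%:C : R[i]^o) @ \oo --> (l%:C : R[i]^o).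
Proof.
(* a positive element of R[i] is real, so the complex radius is e + 0i *)
move=> /cvgrPdist_lt fl; apply/cvgrPdist_lt => -[e i].
rewrite ltcE/= => /andP[/eqP -> e0].
have := fl e e0; apply: filterS => n.
rewrite -ltcR; congr (_ < _).
rewrite -[RHS]/(`|l%:C - (f n)%:C|) -rmorphB/= normc_def/=.
by rewrite expr0n addr0 sqrtr_sqr.
Qed.

Definition real_mittag_leffler {R : realType} (alpha x : R) : R :=
  limn (series (fun n => x ^+ n / Gamma (alpha * n%:R + 1))).

Lemma mittag_leffler_real {R : realType} (alpha x : R) :
  cvgn (series (fun n => x ^+ n / Gamma (alpha * n%:R + 1))) ->
  mittag_leffler alpha x%:C = (real_mittag_leffler alpha x)%:C.
Proof.
move=> /cvg_real_complex cv; rewrite /mittag_leffler.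
apply: (@cvg_lim R[i]^o); first exact: norm_hausdorff.
rewrite (_ : series _ = fun n =>
  (series (fun n => x ^+ n / Gamma (alpha * n%:R + 1)) n)%:C)//.
apply/funext => n; rewrite /series/= rmorph_sum/=; apply: eq_bigr => i _.
by rewrite rmorphM/= rmorphXn/= fmorphV.
Qed.

Lemma mittag_leffler1 {R : realType} (x : R) :
  mittag_leffler 1 x%:C = (expR x)%:C.
Proof.
have e : (fun n => x ^+ n / Gamma (1 * n%:R + 1)) = exp_coeff x.
  by apply/funext => n; rewrite mul1r Gamma_natrS.
rewrite mittag_leffler_real /real_mittag_leffler e//.
exact: is_cvg_series_exp_coeff.
Qed.

(** The terms of degree at least 2 are dominated by the geometric series
    M x ^ 2 (1 + |x| + |x| ^ 2 + ...), whose sum is at most 2 M x ^ 2 when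
    |x| <= 1/2. *)
Lemma bounded_coeff_first_order {R : realType} {a : R^nat} {M x : R} :
  (forall n, `|a n| <= M) -> `|x| <= 2^-1 ->
  cvgn (series (fun n => x ^+ n * a n)) /\
  `|limn (series (fun n => x ^+ n * a n)) - (a 0%N + a 1%N * x)|
    <= 2 * M * x ^+ 2.
Proof.
move=> aM x2.
have M0 : 0 <= M by exact: le_trans (aM 0).
have x1 : `|x| < 1 by apply: le_lt_trans x2 _; lra.
have cv : cvgn (series (fun n => x ^+ n * a n)).
  apply: normed_cvg.
  apply: (series_le_cvg (v_ := geometric M `|x|)) => //.
  - by move=> n /=.
  - by move=> n; exact: geometric_ge0.
  - by move=> n /=; rewrite normrM normrX mulrC ler_wpM2r.
  - by apply: is_cvg_geometric_series; rewrite normr_id.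
split => //.
apply: (@cvgr_to_le _ \oo _ _ (fun n =>
    `|series (fun n => x ^+ n * a n) n - (a 0%N + a 1%N * x)|)).
  by apply: cvg_norm; apply: cvgB => //; exact: cvg_cst.
near=> n.
have n2 : (2 <= n)%N by near: n; exists 2%N.
rewrite -(subnK n2) addn2 /series/= big_nat_recl//= big_nat_recl//=.
rewrite expr0 mul1r expr1 (mulrC x) addrA.
rewrite [_ + \sum_(_ <= _ < _) _]addrC addrK.
apply: le_trans (ler_norm_sum _ _ _) _.
apply: (@le_trans _ _ (\sum_(0 <= i < (n - 2)%N) M * x ^+ 2 * `|x| ^+ i)).
  apply: ler_sum => i _; rewrite normrM normrX exprSr exprSr -mulrA -expr2.
  rewrite real_normK ?num_real// mulrC -mulrA [`|x| ^+ i * _]mulrC.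
  by rewrite ler_wpM2r// mulr_ge0// sqr_ge0.
rewrite [leLHS](_ : _ = series (geometric (M * x ^+ 2) `|x|) (n - 2)%N)//.
rewrite geometric_seriesE ?lt_eqF//= ler_pdivrMr ?subr_gt0//.
have := exprn_ge0 (n - 2) (normr_ge0 x); have := mulr_ge0 M0 (sqr_ge0 x).
rewrite -[2 * M * _]mulrA; move: x2.
set y := `|x| ^+ _; set k := M * _.
nra.
Unshelve. all: end_near. Qed.

(** * Behaviour at the origin *)

Section origin.
Context {R : realType} {alpha : R}.
Hypothesis alpha_gt0 : 0 < alpha.

Lemma real_mittag_leffler_first_order {x : R} : `|x| <= 2^-1 ->
  cvgn (series (fun n => x ^+ n / Gamma (alpha * n%:R + 1))) /\
  `|real_mittag_leffler alpha x - (1 + (Gamma (alpha + 1))^-1 * x)|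
    <= 2 * expR 1 * x ^+ 2.
Proof.
move=> x2.
have aM (n : nat) : `|(Gamma (alpha * n%:R + 1))^-1| <= expR 1.
  have h : expR (- 1) <= Gamma (alpha * n%:R + 1).
    by rewrite expRN1_le_Gamma// mulr_ge0// ltW.
  have g0 := lt_le_trans (expR_gt0 _) h.
  rewrite ger0_norm ?invr_ge0 ?(ltW g0)// -[expR 1]invrK -expRN.
  by rewrite lef_pV2// posrE expR_gt0.
have := bounded_coeff_first_order aM x2.
by rewrite mulr0 mulr1 (Gamma_natrS 0) invr1.
Qed.

Lemma nbhs_right0_normM_le_half (k : R) :
  \forall tau \near 0^'+, `|k * tau| <= 2^-1.
Proof.
near=> tau.
have t0 : 0 < tau by near: tau; exact: nbhs_right_gt.
rewrite normrM (gtr0_norm t0).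
have : tau <= 2^-1 / (`|k| + 1).
  by near: tau; apply: nbhs_right_le; rewrite divr_gt0// ltr_wpDl.
rewrite ler_pdivlMr ?ltr_wpDl// => h.
by apply: le_trans h; rewrite mulrC ler_wpM2l ?(ltW t0)// lerDl.
Unshelve. all: end_near. Qed.

Lemma cvg_quotient_real_mittag_leffler (k : R) :
  (real_mittag_leffler alpha (k * tau) - 1) / tau @[tau --> 0^'+]
    --> k / Gamma (alpha + 1).
Proof.
(* adding 1 makes the error constant positive even for k = 0, hence fit to
   divide by *)
have p : 0 < 2 * expR 1 * k ^+ 2 + 1.
  by rewrite ltr_wpDl// mulr_ge0 ?sqr_ge0// mulr_ge0// expR_ge0.
apply/cvgrPdist_le => e e0; near=> tau.
have t0 : 0 < tau by near: tau; exact: nbhs_right_gt.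
have tk : `|k * tau| <= 2^-1.
  by near: tau; exact: nbhs_right0_normM_le_half.
have te : tau * (2 * expR 1 * k ^+ 2 + 1) <= e.
  by rewrite -ler_pdivlMr//; near: tau; apply: nbhs_right_le; rewrite divr_gt0.
have [_ h] := real_mittag_leffler_first_order tk.
rewrite distrC -[X in _ - X](mulfK (lt0r_neq0 t0)) -mulrBl normrM.
rewrite normfV (gtr0_norm t0) ler_pdivrMr//.
rewrite (_ : _ - _ - _ = real_mittag_leffler alpha (k * tau)
    - (1 + (Gamma (alpha + 1))^-1 * (k * tau))); last by ring.
apply: le_trans h _; rewrite exprMn.
apply: le_trans (ler_wpM2r (ltW t0) te).
rewrite (_ : tau * _ * tau
    = 2 * expR 1 * (k ^+ 2 * tau ^+ 2) + tau ^+ 2); last by ring.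
by rewrite lerDl sqr_ge0.
Unshelve. all: end_near. Qed.

(** Writing q for the quotient (E(lambda tau) - 1) / tau, the hypothesis turns
    (E(2 ^ alpha lambda tau) - 1) / tau into q (2 + tau q).  The two sides tend
    to 2 ^ alpha lambda c and 2 lambda c, where c = 1 / Gamma (alpha + 1). *)
Lemma eq1_of_mittag_leffler_doubling {lambda : R} : lambda != 0 ->
  (forall tau : R, 0 <= tau ->
    mittag_leffler alpha (2 `^ alpha * lambda * tau)%:C
    = mittag_leffler alpha (lambda * tau)%:C ^+ 2) -> alpha = 1.
Proof.
move=> l0 dbl.
pose E := real_mittag_leffler alpha; pose c := (Gamma (alpha + 1))^-1.
have c0 : c != 0.
  rewrite invr_neq0// lt0r_neq0// (lt_le_trans (expR_gt0 (- 1)))//.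
  by rewrite expRN1_le_Gamma// ltW.
pose q (tau : R) := (E (lambda * tau) - 1) / tau.
have q_cvg : q tau @[tau --> 0^'+] --> lambda * c.
  exact: cvg_quotient_real_mittag_leffler.
have sq_cvg : q tau * (2 + tau * q tau) @[tau --> 0^'+]
    --> lambda * c * (2 + 0 * (lambda * c)).
  apply: cvgM => //; apply: cvgD; first exact: cvg_cst.
  by apply: cvgM => //; apply: cvg_at_right_filter; exact: cvg_id.
have : 2 `^ alpha * lambda * c = lambda * c * (2 + 0 * (lambda * c)).
  apply: (cvg_unique _
    (cvg_quotient_real_mittag_leffler (2 `^ alpha * lambda))) => //.
  apply: cvg_trans sq_cvg; apply: near_eq_cvg; near=> tau.
  have t0 : 0 < tau by near: tau; exact: nbhs_right_gt.
  have small1 : `|lambda * tau| <= 2^-1.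
    by near: tau; exact: nbhs_right0_normM_le_half.
  have small2 : `|2 `^ alpha * lambda * tau| <= 2^-1.
    by near: tau; exact: nbhs_right0_normM_le_half.
  have [cv1 _] := real_mittag_leffler_first_order small1.
  have [cv2 _] := real_mittag_leffler_first_order small2.
  have := dbl tau (ltW t0).
  rewrite !mittag_leffler_real// -rmorphXn => /complexI /= E2.
  by rewrite E2 /q /E; field; exact: lt0r_neq0.
rewrite mul0r addr0 -mulrA mulrC => /mulfI; rewrite mulf_neq0// => /(_ isT).
move=> /(congr1 (@ln R)); rewrite ln_powR => h.
have ln2 : ln (2 : R) != 0 by rewrite gt_eqF// ln_gt0// ltr1n.
by apply: (mulIf ln2); rewrite mul1r.
Unshelve. all: end_near. Qed.

End origin.

Theorem corollary5 (R : realType) (alpha lambda : R)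
    (alpha_gt0 : 0 < alpha) (alpha_le1 : alpha <= 1) :
  (forall t s : R, 0 <= t -> 0 <= s ->
     mittag_leffler alpha (lambda * (t + s) `^ alpha)%:C
     = mittag_leffler alpha (lambda * t `^ alpha)%:C
       * mittag_leffler alpha (lambda * s `^ alpha)%:C)
  <-> (alpha = 1 \/ lambda = 0).
Proof.
split=> [feq|[->|->] t s t0 s0].
- have [->|l0] := eqVneq lambda 0; [by right|left].
  apply: (eq1_of_mittag_leffler_doubling alpha_gt0 l0) => tau tau0.
  have tauE : (tau `^ alpha^-1) `^ alpha = tau.
    by rewrite -powRrM mulVf ?lt0r_neq0// powRr1.
  have argE : lambda * (tau `^ alpha^-1 + tau `^ alpha^-1) `^ alpha
      = 2 `^ alpha * lambda * tau.
    rewrite (_ : _ + _ = 2 * tau `^ alpha^-1); last by ring.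
    by rewrite powRM ?powR_ge0// tauE mulrCA mulrA.
  have e := feq _ _ (powR_ge0 tau alpha^-1) (powR_ge0 tau alpha^-1).
  by rewrite argE tauE in e; rewrite expr2; exact: e.
- rewrite !powRr1 ?addr_ge0// !mittag_leffler1.
  by rewrite mulrDr expRD rmorphM.
- (* at x = 0 the error of the first-order expansion vanishes: E(0) = 1 *)
  have h0 : `|0 : R| <= 2^-1 by rewrite normr0 invr_ge0.
  have [cv h] := real_mittag_leffler_first_order alpha_gt0 h0.
  rewrite !mul0r mittag_leffler_real//.
  move: h; rewrite mulr0 addr0 expr0n mulr0 normr_le0 subr_eq0 => /eqP ->.
  by rewrite mulr1.
Qed.
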